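(* There exist an integer $q\ge2$, a connected constraint graph $H\ne K_q^+$ on $\{0,1,\dots,q-1\}$, a color $r\in\{1,\dots,q-1\}$, and a sequence of finite simple graphs $\{G_N\}_{N\in\mathbb{N}}$ with uniformly bounded maximum degree, $|V(G_N)|\to\infty$ and $\Omega_{G_N}(H)\neq\emptyset$, such that: (i) there is a constant $K$ with $c^N_r(\vec\sigma)\le K$ for all $N$ and all $\vec\sigma\in\Omega_{G_N}(H)$; (ii) for every $\boldsymbol\beta\in\mathbb{R}^{q-1}$ the condition $\lim_{\varepsilon\to0}\liminf_{N\to\infty}\mathbb{P}^N_{\boldsymbol\beta}(u^N_r(\vec\sigma)>\varepsilon|V(G_N)|)=1$ fails; and (iii) there is no consistent sequence of estimates for the $H$-coloring model on $\{G_N\}_{N\in\mathbb{N}}$.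
   Context: A constraint graph $H$ has vertex set (colors) $\{0,1,\dots,q-1\}$, possibly with self-loops but no multiple edges; $\mathcal{N}_H(s)=\{t:(s,t)\in E(H)\}$. $K_q^+$ is the complete graph on $\{0,\dots,q-1\}$ with a self-loop at every vertex. $\Omega_{G_N}(H)$ is the set of $\vec\sigma\in\{0,\dots,q-1\}^{V(G_N)}$ such that $(u,v)\in E(G_N)$ implies $(\sigma_u,\sigma_v)\in E(H)$. With $\beta_0:=0$ and $c^N_s(\vec\sigma)=|\{u:\sigma_u=s\}|$, the $H$-coloring model with parameter $\boldsymbol\beta=(\beta_1,\dots,\beta_{q-1})\in\mathbb{R}^{q-1}$ is the probability measure on $\Omega_{G_N}(H)$ with $\mathbb{P}^N_{\boldsymbol\beta}(\vec\sigma)\propto\exp\{\sum_{s=1}^{q-1}\beta_s c^N_s(\vec\sigma)\}$. $u^N_r(\vec\sigma)$ is the number of $u\in V(G_N)$ such that $\sigma_v\in\mathcal{N}_H(r)$ for all neighbors $v$ of $u$ in $G_N$. A sequence of estimates (functions $\check{\boldsymbol\beta}^N$ of a single sample $\vec\sigma\sim\mathbb{P}^N_{\boldsymbol\beta}$ with values in $\mathbb{R}^{q-1}$) is consistent if, for every $\boldsymbol\beta\in\mathbb{R}^{q-1}$, $\check{\boldsymbol\beta}^N$ converges in probability to $\boldsymbol\beta$ under $\mathbb{P}^N_{\boldsymbol\beta}$. *)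

(* Defs.v *)
From mathcomp Require Import all_boot all_order all_algebra.
From mathcomp Require Import all_classical all_reals all_analysis.

Set Implicit Arguments.
Unset Strict Implicit.
Unset Printing Implicit Defensive.

Import Order.TTheory GRing.Theory Num.Theory.
Import numFieldNormedType.Exports.

Local Open Scope ring_scope.

Record constraint_graph (q : nat) := ConstraintGraph {
  cedge :> rel 'I_q;
  _ : symmetric cedge
}.

Definition Kplus_edge (q : nat) : rel 'I_q := fun _ _ => true.

Definition nbr_colors (q : nat) (H : constraint_graph q) (s : 'I_q)
  : {set 'I_q} := [set t | H s t]%SET.

Definition cg_connected (q : nat) (H : constraint_graph q) : Prop :=
  forall s t : 'I_q, connect H s t.

Record simple_graph := SimpleGraph {
  vertex :> finType;
  adj : rel vertex;
  _ : symmetric adj;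
  _ : irreflexive adj
}.

Definition degree (G : simple_graph) (v : G) : nat :=
  #|[set w | adj v w]%SET|.

Definition coloring (G : simple_graph) (q : nat) := {ffun G -> 'I_q}.

Definition Omega (G : simple_graph) (q : nat) (H : constraint_graph q)
  : {set coloring G q} :=
  [set sigma : coloring G q |
    [forall u, forall v, adj u v ==> H (sigma u) (sigma v)]]%SET.

(* The color s is a natural number, so that both ordinals and the shifted
   indices of [weight] below can be used. *)
Definition color_count (G : simple_graph) (q : nat) (s : nat)
    (sigma : coloring G q) : nat :=
  #|[set u | sigma u == s :> nat]%SET|.

Definition u_count (G : simple_graph) (q : nat) (H : constraint_graph q)
    (r : 'I_q) (sigma : coloring G q) : nat :=
  #|[set u | [forall v, adj u v ==> (sigma v \in nbr_colors H r)]]%SET|.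

(* The parameter is the row vector (beta_1, ..., beta_{q-1}); its entry with
   index j is the coefficient of color j.+1.  Color 0 has coefficient 0. *)
Definition weight (R : realType) (G : simple_graph) (q : nat)
    (beta : 'rV[R]_q.-1) (sigma : coloring G q) : R :=
  expR (\sum_(j < q.-1) beta ord0 j * (color_count j.+1 sigma)%:R).

Definition partition_function (R : realType) (G : simple_graph) (q : nat)
    (H : constraint_graph q) (beta : 'rV[R]_q.-1) : R :=
  \sum_(sigma in Omega G H) weight beta sigma.

(* A probability only when Omega G H is nonempty; otherwise it is the junk
   value 0. *)
Definition gibbs_prob (R : realType) (G : simple_graph) (q : nat)
    (H : constraint_graph q) (beta : 'rV[R]_q.-1)
    (A : pred (coloring G q)) : R :=
  (\sum_(sigma in Omega G H | A sigma) weight beta sigma)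
  / partition_function G H beta.

Local Open Scope classical_set_scope.

(* lim_{e -> 0+} liminf_N P(u_r > e |V(G_N)|) = 1.  The liminf is taken in the
   extended reals, where it always exists. *)
Definition linearly_many_unconstrained (R : realType) (G : nat -> simple_graph)
    (q : nat) (H : constraint_graph q) (r : 'I_q) (beta : 'rV[R]_q.-1)
  : Prop :=
  limn_einf (fun N : nat =>
    (gibbs_prob H beta (fun sigma : coloring (G N) q =>
       e * #|G N|%:R < (u_count H r sigma)%:R))%:E) @[e --> (0 : R)^'+]
    --> 1%E.

(* The norm is the sup norm on row vectors.  Only the values of an estimate
   on Omega (G N) H matter, since gibbs_prob is supported there. *)
Definition consistent (R : realType) (G : nat -> simple_graph) (q : nat)
    (H : constraint_graph q)
    (est : forall N : nat, coloring (G N) q -> 'rV[R]_q.-1) : Prop :=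
  forall (beta : 'rV[R]_q.-1) (e : R), 0 < e ->
    gibbs_prob H beta (fun sigma : coloring (G N) q =>
      e < `|est N sigma - beta|) @[N --> \oo] --> (0 : R).

(* Main.v *)
Require Import Defs.
From mathcomp Require Import all_boot all_order all_algebra.
From mathcomp Require Import all_classical all_reals all_analysis.
From mathcomp Require Import lra.

Import Order.TTheory GRing.Theory Num.Theory.
Import numFieldNormedType.Exports.

Local Open Scope ring_scope.
Local Open Scope classical_set_scope.

(** The constraint graph is the path 2 - 0 - 1 with a self-loop at 1, and G_N
    is a disjoint union of N + 1 triangles.  The only neighbor of color 2 is
    color 0, which has no loop, so no closed walk of length 3 visits color 2.
    Hence color 2 never occurs in a coloring of G_N, nor are both neighbors of
    a vertex ever in N_H(2): both counts vanish identically, and the law of the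
    model does not depend on beta_2. *)

Section Gibbs.
Context {R : realType} {G : simple_graph} {q : nat} (H : constraint_graph q).
Implicit Types (beta : 'rV[R]_q.-1) (A B : pred (coloring G q)).

Lemma partition_function_gt0 beta :
  Omega G H != finset.set0 -> 0 < partition_function G H beta.
Proof.
case/finset.set0Pn => sigma sigmaO.
rewrite /partition_function (bigD1 sigma) //= ltr_pwDl ?expR_gt0 //.
by apply: sumr_ge0 => tau _; exact: expR_ge0.
Qed.

Lemma gibbs_prob0 beta A : {in Omega G H, forall sigma, ~~ A sigma} ->
  gibbs_prob H beta A = 0.
Proof.
move=> A0; rewrite /gibbs_prob big1 ?mul0r // => sigma /andP[/A0/negP].
by [].
Qed.

(** Union bound: the whole sample space has mass 1, and every coloring contributes to at least one
    of the two sums. *)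
Lemma gibbs_prob_cover beta A B : Omega G H != finset.set0 ->
  (forall sigma, A sigma || B sigma) ->
  1 <= gibbs_prob H beta A + gibbs_prob H beta B.
Proof.
move=> O0 AB; have Z0 := partition_function_gt0 beta O0.
rewrite /gibbs_prob -mulrDl ler_pdivlMr // mul1r /partition_function.
rewrite !big_mkcondr -big_split /=; apply: ler_sum => sigma _.
have w0 : 0 <= weight beta sigma by exact: expR_ge0.
by have := AB sigma; case: (A sigma); case: (B sigma) => //= _; lra.
Qed.

(** Entry [i] enters the weight only through its product with the count of color [i.+1], which
    vanishes, so neither numerator nor normalization sees it. *)
Lemma gibbs_prob_unused_color (i : 'I_q.-1) beta beta' A :
  (forall j, j != i -> beta ord0 j = beta' ord0 j) ->
  {in Omega G H, forall sigma, color_count i.+1 sigma = 0%N} ->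
  gibbs_prob H beta A = gibbs_prob H beta' A.
Proof.
move=> bb' ci0.
have weightE : {in Omega G H, weight beta =1 weight beta'}.
  move=> sigma /ci0 c0; congr expR; apply: eq_bigr => j _.
  by have [->|/bb' ->//] := eqVneq j i; rewrite c0 !mulr0.
rewrite /gibbs_prob /partition_function; congr (_ / _).
- by apply: eq_bigr => sigma /andP[+ _]; exact: weightE.
- by apply: eq_bigr => sigma; exact: weightE.
Qed.

End Gibbs.

Section Sequences.
Context {R : realType} {G : nat -> simple_graph} {q : nat}.
Variable H : constraint_graph q.

(** For each [e > 0] the event is empty, so the liminf is 0 and the limit at [0^'+] is 0 rather than
    1. *)
Lemma u_count0_not_linear (r : 'I_q) (beta : 'rV[R]_q.-1) :
  (forall N, {in Omega (G N) H, forall sigma, u_count H r sigma = 0%N}) ->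
  ~ linearly_many_unconstrained G H r beta.
Proof.
move=> u0 lin1.
suff lin0 : limn_einf (fun N : nat =>
    (gibbs_prob H beta (fun sigma : coloring (G N) q =>
       e * #|G N|%:R < (u_count H r sigma)%:R))%:E) @[e --> (0 : R)^'+]
    --> 0%E.
  have /eqP : 1%E = 0%E :> \bar R.
    exact: (cvg_unique (@ereal_hausdorff R) lin1 lin0).
  by rewrite eqe oner_eq0.
apply: cvg_near_cst; near=> e.
rewrite (_ : (fun N : nat => _) = cst 0%E); last first.
  apply/funext => N; rewrite gibbs_prob0 // => sigma /u0 ->.
  by rewrite -leNgt mulr_ge0.
by rewrite is_cvg_limn_einfE; [exact: lim_cst|exact: is_cvg_cst].
Unshelve. all: by end_near. Qed.

(** Two-point argument: the parameters 0 and [b] are at distance 1 but induce the same law, so one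
    estimate cannot concentrate near both. *)
Lemma unused_color_not_consistent (i : 'I_q.-1) :
  (forall N, Omega (G N) H != finset.set0) ->
  (forall N, {in Omega (G N) H, forall sigma, color_count i.+1 sigma = 0%N}) ->
  ~ exists est : forall N, coloring (G N) q -> 'rV[R]_q.-1, consistent H est.
Proof.
move=> O0 ci0 [est cons].
pose b : 'rV[R]_q.-1 := delta_mx ord0 i.
(* Any radius below 1/2 would do: the balls around 0 and [b] must be disjoint. *)
have e0 : 0 < 3^-1 :> R by rewrite invr_gt0.
have sum0 := cvgD (cons 0 _ e0) (cons b _ e0).
suff : (1 : R) <= 0 + 0 by rewrite addr0 ler10.
apply: (cvgr_to_ge (sum0 _)).
apply: nearW => N; rewrite fctE.
(* Both deviation events are now measured under the law with parameter 0. If neither occurred, the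
   triangle inequality would give norm at most 2/3 for [b]. *)
rewrite [X in _ + X](@gibbs_prob_unused_color _ _ _ _ i _ 0); last exact: ci0.
  apply: gibbs_prob_cover => // sigma; rewrite !ltNge -negb_and.
  apply/negP => /andP[le0 leb].
  have : `|b| <= 3^-1 + 3^-1.
    rewrite -[b](subrK (est N sigma)) (le_trans (ler_normD _ _)) //.
    by rewrite lerD // ?(distrC b) // -[est N sigma]subr0.
  suff : 1 <= `|b| by lra.
  rewrite [`|b|]mx_normrE (le_trans _ (le_bigmax _ _ (ord0, i))) //=.
  by rewrite mxE !eqxx normr1.
by move=> j ji; rewrite !mxE (negbTE ji) andbF.
Qed.

End Sequences.

(** The sum of two colors is 1 or 2 exactly for the pairs {0,1}, {0,2} and {1,1}. *)
Definition looped_path_edge : rel 'I_3 := fun s t => (0 < s + t < 3)%N.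

Lemma looped_path_edge_sym : symmetric looped_path_edge.
Proof. by move=> s t; rewrite /looped_path_edge addnC. Qed.

Definition looped_path : constraint_graph 3 :=
  ConstraintGraph looped_path_edge_sym.

Lemma looped_path_connected : cg_connected looped_path.
Proof.
have csym : connect_sym looped_path.
  exact: (sym_connect_sym looped_path_edge_sym).
suff c0 t : connect looped_path ord0 t.
  by move=> s t; apply: connect_trans (c0 t); rewrite csym.
by have [->//|t0] := eqVneq t ord0; apply: connect1; case: t t0 => -[|[|[]]].
Qed.

(** Both colors are forced to be 0, which has no loop. *)
Lemma looped_path_nbr2 (s t : 'I_3) : looped_path ord_max s ->
  looped_path ord_max t -> ~~ looped_path s t.
Proof. by case: s t => -[|[|[]]] // ? [[|[|[]]]]. Qed.

Section Triangles.
Variable N : nat.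

(** The first component names the triangle, the second its corner. *)
Definition triangles_adj : rel ('I_N.+1 * 'I_3) :=
  fun u v => (u.1 == v.1) && (u.2 != v.2).

Lemma triangles_adj_sym : symmetric triangles_adj.
Proof.
by move=> u v; rewrite /triangles_adj eq_sym [in X in _ && X]eq_sym.
Qed.

Lemma triangles_adj_irr : irreflexive triangles_adj.
Proof. by move=> u; rewrite /triangles_adj !eqxx. Qed.

Definition triangles : simple_graph :=
  SimpleGraph triangles_adj_sym triangles_adj_irr.

Lemma card_triangles : #|triangles| = (N.+1 * 3)%N.
Proof. by rewrite card_prod !card_ord. Qed.

(** Neighbors of [v] lie in one triangle, so [snd] is injective on them; the crude bound 3
    suffices. *)
Lemma triangles_degree (v : triangles) : (degree v <= 3)%N.
Proof.
rewrite /degree -(@card_in_imset _ _ snd) => [|[a i] [b j]].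
  by rewrite (leq_trans (max_card _)) ?card_ord.
by rewrite !inE => /andP[/= /eqP<- _] /andP[/= /eqP<- _] ->.
Qed.

Lemma triangle_at (u : triangles) :
  exists v w : triangles, [/\ adj u v, adj u w & adj v w].
Proof.
(* Addition in ['I_3] is modulo 3, so these are the other two corners. *)
case: u => a i; exists (a, i + 1), (a, i + 2).
by rewrite /adj /= /triangles_adj /= eqxx; case: i => -[|[|[]]].
Qed.

Lemma OmegaP (sigma : coloring triangles 3) :
  reflect (forall u v : triangles, adj u v -> looped_path (sigma u) (sigma v))
          (sigma \in Omega triangles looped_path).
Proof.
rewrite inE; apply: (iffP forallP) => [sigmaO u v uv|sigmaO u].
  by move/forallP/(_ v)/implyP: (sigmaO u); exact.
by apply/forallP => v; apply/implyP; exact: sigmaO.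
Qed.

Lemma Omega_triangles_neq0 : Omega triangles looped_path != finset.set0.
Proof.
(* The constant coloring 1 is admissible thanks to the loop at 1. *)
by apply/finset.set0Pn; exists [ffun => inord 1]; apply/OmegaP => u v _;
  rewrite !ffunE /= /looped_path_edge inordK.
Qed.

Lemma color_count2_eq0 :
  {in Omega triangles looped_path, forall sigma, color_count 2 sigma = 0%N}.
Proof.
move=> sigma /OmegaP O; apply/eqP; rewrite cards_eq0; apply/eqP/setP => u.
rewrite !inE; apply/negP => /eqP su.
have [v [w [uv uw vw]]] := triangle_at u.
have su2 : sigma u = ord_max by exact: val_inj.
have := O _ _ vw; apply/negP/looped_path_nbr2; rewrite -su2; exact: O.
Qed.

(** The same contradiction on a triangle, using only the colors of the two neighbors of [u]. *)
Lemma u_count2_eq0 : {in Omega triangles looped_path,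
  forall sigma, u_count looped_path ord_max sigma = 0%N}.
Proof.
move=> sigma /OmegaP O; apply/eqP; rewrite cards_eq0; apply/eqP/setP => u.
rewrite !inE; apply/negP => /forallP nbr.
have [v [w [uv uw vw]]] := triangle_at u.
have := O _ _ vw; apply/negP/looped_path_nbr2.
- by have /implyP/(_ uv) := nbr v; rewrite inE.
- by have /implyP/(_ uw) := nbr w; rewrite inE.
Qed.

End Triangles.

Theorem mainTheorem6 (R : realType) :
  exists (q : nat) (H : constraint_graph q) (r : 'I_q)
         (G : nat -> simple_graph),
    [/\ (2 <= q)%N, cg_connected H, ~ (cedge H =2 @Kplus_edge q)
      & (0 < r)%N] /\
    [/\ exists D : nat, forall (N : nat) (v : G N), (degree v <= D)%N,
        #|G N| @[N --> \oo] --> \oo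
      & forall N : nat, Omega (G N) H != finset.set0] /\
    [/\ exists K : nat, forall (N : nat) (sigma : coloring (G N) q),
          sigma \in Omega (G N) H -> (color_count r sigma <= K)%N,
        forall beta : 'rV[R]_q.-1, ~ linearly_many_unconstrained G H r beta
      & ~ exists est : forall N : nat, coloring (G N) q -> 'rV[R]_q.-1,
          consistent H est].
Proof.
exists 3%N, looped_path, ord_max, triangles; split; [|split]; split => //.
- exact: looped_path_connected.
- by move/(_ ord0 ord0).
- by exists 3%N; exact: triangles_degree.
- apply/cvgnyPge => A; near=> N; rewrite card_triangles.
  have AN : (A <= N)%N by near: N; exact: nbhs_infty_ge.
  by rewrite (leq_trans AN) // (leq_trans (leqnSn N)) // leq_pmulr.
- exact: Omega_triangles_neq0.
- by exists 0%N => N sigma /color_count2_eq0 ->.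
- by move=> beta; apply: u_count0_not_linear; exact: u_count2_eq0.
(* Here [ord_max] lives in ['I_2]: it is the index 1, whose color is 2. *)
- apply: (@unused_color_not_consistent R triangles 3 looped_path ord_max).
  + exact: Omega_triangles_neq0.
  + exact: color_count2_eq0.
Unshelve. all: by end_near. Qed.
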